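(* Let $q$ be a prime power, let $n,d,\ell$ be positive integers with $\ell\ge n$, and let $k_0=\log_q A_q^{\mathrm{Lin}}(n,d)$. If $k_0\ge2$, then the polytope $P(n,d,\ell)$ is not integral, i.e., there is a point $\widetilde{\mathbb{P}}\in P(n,d,\ell)$ and a subspace $S\le\mathbb{F}_q^n$ with $\widetilde{\mathbb{P}}[S]<0$.
   Context: For $w\in\mathbb{F}_q^n$, $|w|$ is the Hamming weight (number of nonzero coordinates), and $[d-1]=\{1,\dots,d-1\}$. $S\le T$ means that $S$ is a linear subspace of $T$. $A_q^{\mathrm{Lin}}(n,d)$ is the maximum cardinality of a linear subspace $\mathcal{C}\le\mathbb{F}_q^n$ containing no $w$ with $|w|\in[d-1]$; thus $k_0$ is the maximum dimension of such a subspace. $P(n,d,\ell)$ (the feasible region of the pseudoprobability formulation of the Krawtchouk LP hierarchy) is the set of real vectors $(\widetilde{\mathbb{P}}[S])_{S\le\mathbb{F}_q^n}$, indexed by the linear subspaces of $\mathbb{F}_q^n$, such that (1) $\sum_{S\le\mathbb{F}_q^n}\widetilde{\mathbb{P}}[S]=1$; (2) $\widetilde{\mathbb{P}}[S]=0$ whenever there is $w\in S$ with $|w|\in[d-1]$; (3) $\sum_{S\le U}|S|^\ell\,\widetilde{\mathbb{P}}[S]\ge0$ for all $U\le\mathbb{F}_q^n$; (4) $\sum_{U\le S\le\mathbb{F}_q^n}\widetilde{\mathbb{P}}[S]\ge0$ for all $U\le\mathbb{F}_q^n$. The polytope is called integral when all of its points have nonnegative coordinates (so that, by (1), they are probability distributions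 on subspaces). *)

(* Defs.v *)
From HB Require Import structures.
From mathcomp Require Import all_boot all_order all_algebra.
From mathcomp Require Import reals.

Set Implicit Arguments.
Unset Strict Implicit.
Unset Printing Implicit Defensive.

Import Order.TTheory GRing.Theory Num.Theory.

Local Open Scope ring_scope.

(* MathComp only makes [{vspace vT}] a choiceType; over a finite field it is
   finite, being a retract of a type of square matrices. *)
HB.instance Definition _ (F : finFieldType) (vT : vectType F) :=
  Choice_isCountable.Build {vspace vT}
    (pcan_pickleK (can_pcan (@VectorInternalTheory.vs2mxK F vT))).
HB.instance Definition _ (F : finFieldType) (vT : vectType F) :=
  isFinite.Build {vspace vT}
    (pcan_enumP (can_pcan (@VectorInternalTheory.vs2mxK F vT))).

Definition hamming_weight (F : finFieldType) (n : nat) (w : 'rV[F]_n) : nat :=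
  #|[set i : 'I_n | w 0 i != 0]|.

Definition has_low_weight (F : finFieldType) (n d : nat)
    (S : {vspace 'rV[F]_n}) : bool :=
  [exists w : 'rV[F]_n, (w \in S) && (1 <= hamming_weight w <= d.-1)%N].

Definition ALin (F : finFieldType) (n d : nat) : nat :=
  \max_(C : {vspace 'rV[F]_n} | ~~ has_low_weight d C) #|C|.

Record in_polytope (R : realType) (F : finFieldType) (n d l : nat)
    (P : {ffun {vspace 'rV[F]_n} -> R}) : Prop := InPolytope {
  polytope_sum1 : \sum_(S : {vspace 'rV[F]_n}) P S = 1;
  polytope_support :
    forall S : {vspace 'rV[F]_n}, has_low_weight d S -> P S = 0;
  polytope_below : forall U : {vspace 'rV[F]_n},
    0 <= \sum_(S : {vspace 'rV[F]_n} | (S <= U)%VS) #|S|%:R ^+ l * P S;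
  polytope_above : forall U : {vspace 'rV[F]_n},
    0 <= \sum_(S : {vspace 'rV[F]_n} | (U <= S)%VS) P S
}.

Definition polytope_integral (R : realType) (F : finFieldType)
    (n d l : nat) : Prop :=
  forall P : {ffun {vspace 'rV[F]_n} -> R},
    in_polytope d l P -> forall S : {vspace 'rV[F]_n}, 0 <= P S.

Lemma card_vspace_rV (F : finFieldType) (n : nat) (S : {vspace 'rV[F]_n}) :
  #|S| = (#|F| ^ \dim S)%N.
Proof.
pose f (u : 'rV[F]_(\dim S)) := \sum_i u 0 i *: (vbasis S)`_i.
have f_inj : injective f.
  move=> u v euv; apply/rowP => i.
  have fr := basis_free (vbasisP S).
  have ->: u 0 i = coord (vbasis S) i (f u) by rewrite coord_sum_free.
  by rewrite euv coord_sum_free.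
have -> : #|S| = #|codom f|.
  apply: eq_card => w; apply/idP/idP => [wS|/codomP[u ->]].
    apply/codomP; exists (\row_i coord (vbasis S) i w).
    by rewrite [LHS](coord_vbasis wS); apply: eq_bigr => i _; rewrite mxE.
  apply: memv_suml => i _; apply/memvZ/vbasis_mem/mem_nth.
  by rewrite size_tuple.
by rewrite card_codom // card_mx mul1n.
Qed.

(* Hence [log_q (ALin F n d)] is always a natural number. *)
Lemma ALin_expn (F : finFieldType) (n d : nat) :
  exists k : nat, ALin F n d = (#|F| ^ k)%N.
Proof.
have code0 : ~~ has_low_weight d (0%VS : {vspace 'rV[F]_n}).
  apply/existsPn => w; rewrite memv0; apply/negP => /andP[/eqP->].
  have -> : hamming_weight (0 : 'rV[F]_n) = 0%N; last by [].
  by apply/eqP; rewrite cards_eq0; apply/eqP/setP => i; rewrite !inE mxE eqxx.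
pose codes := [pred C : {vspace 'rV[F]_n} | ~~ has_low_weight d C].
have codes_gt0 : (0 < #|codes|)%N by apply/card_gt0P; exists 0%VS.
have [C _ eC] := eq_bigmax_cond
  (fun C : {vspace 'rV[F]_n} => #|C|) codes_gt0.
by exists (\dim C); rewrite -card_vspace_rV -eC.
Qed.

(* Main.v *)
(** If [0 < T < C] with [C] a code, then the point with value [1] at [0], [-e]
    at [T] and [e] at [C], where [e = |T|^-l], lies in the polytope: above [T],
    its negative mass is compensated by [C], and below [T], by [0], whose mass
    is exactly [|T|^l * e]. Such a [T] exists as soon as [C] has dimension at
    least 2. *)
Require Import Defs.
From HB Require Import structures.
From mathcomp Require Import all_boot all_order all_algebra.
From mathcomp Require Import reals.

Set Implicit Arguments.
Unset Strict Implicit.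
Unset Printing Implicit Defensive.

Import Order.TTheory GRing.Theory Num.Theory.

Local Open Scope ring_scope.

Lemma sum_mul_eq (R : nzRingType) (I : finType) (Q : pred I) (f : I -> R)
    (a : I) :
  \sum_(i | Q i) f i * (i == a)%:R = (Q a)%:R * f a.
Proof.
have off i : i != a -> f i * (i == a)%:R = 0.
  by move=> /negPf->; rewrite mulr0.
case Qa: (Q a); last first.
  rewrite mul0r big1 // => i Qi; apply: off.
  by apply: contraTneq Qi => ->; rewrite Qa.
rewrite (bigD1 a) //= eqxx mulr1 mul1r big1 ?addr0 // => i /andP[_].
exact: off.
Qed.

Lemma card_vspace_gt0 (F : finFieldType) (n : nat)
    (S : {vspace 'rV[F]_n}) : (0 < #|S|)%N.
Proof. by apply/card_gt0P; exists 0; exact: mem0v. Qed.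

Lemma has_low_weightS (F : finFieldType) (n d : nat)
    (S C : {vspace 'rV[F]_n}) :
  (S <= C)%VS -> has_low_weight d S -> has_low_weight d C.
Proof.
move=> /subvP sSC /existsP[w /andP[wS hw]].
by apply/existsP; exists w; rewrite sSC.
Qed.

Lemma ALin_attained (F : finFieldType) (n d k : nat) :
  ALin F n d = (#|F| ^ k)%N ->
  exists2 C : {vspace 'rV[F]_n}, ~~ has_low_weight d C & \dim C = k.
Proof.
move=> hk; pose codes := [pred C : {vspace 'rV[F]_n} | ~~ has_low_weight d C].
have F_gt1 : (1 < #|F|)%N by exact: card_finNzRing_gt1.
(* A maximum over no codes would default to [0], which is not a power of [#|F|]. *)
have codes_gt0 : (0 < #|codes|)%N.
  rewrite lt0n; apply/negP => /eqP/card0_eq no_code.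
  have : ALin F n d = 0%N by rewrite /ALin big_pred0.
  by rewrite hk => /eqP; rewrite expn_eq0 -leqn0 leqNgt ltnW.
have [C codeC eC] := eq_bigmax_cond
  (fun C : {vspace 'rV[F]_n} => #|C|) codes_gt0.
exists C => //; apply: (expnI F_gt1).
by rewrite -card_vspace_rV -hk -eC.
Qed.

Section SignedPoint.
Variables (R : realType) (F : finFieldType) (n d l : nat).
Variables (T C : {vspace 'rV[F]_n}).

Let e : R := (#|T|%:R ^+ l)^-1.

Definition signed_point : {ffun {vspace 'rV[F]_n} -> R} :=
  [ffun S => (S == 0%VS)%:R - e * (S == T)%:R + e * (S == C)%:R].

(** Each sum in the polytope conditions has this shape, with [f] constantly [1] or [f S] equal to
    [#|S|%:R ^+ l], so checking it reduces to comparing three terms. *)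
Lemma sum_signed_point (Q : pred {vspace 'rV[F]_n})
    (f : {vspace 'rV[F]_n} -> R) :
  \sum_(S | Q S) f S * signed_point S =
  (Q 0%VS)%:R * f 0%VS - e * ((Q T)%:R * f T) + e * ((Q C)%:R * f C).
Proof.
rewrite -!sum_mul_eq !mulr_sumr -sumrB -big_split /=.
apply: eq_bigr => S _; rewrite ffunE mulrDr mulrBr.
by rewrite !(mulrCA (f S) e).
Qed.

Lemma signed_point_weight_gt0 : 0 < e.
Proof. by rewrite invr_gt0 exprn_gt0 // ltr0n card_vspace_gt0. Qed.

(** Distinctness keeps the mass [- e] at [T] from merging with the positive masses at [0] and
    [C]. *)
Lemma signed_point_lt0 :
  T != 0%VS -> T != C -> signed_point T < 0.
Proof.
move=> T_neq0 T_neqC; rewrite ffunE (negPf T_neq0) (negPf T_neqC) eqxx mulr0 mulr1 addr0 sub0r.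
by rewrite oppr_lt0 signed_point_weight_gt0.
Qed.

Lemma signed_point_in_polytope :
  (T <= C)%VS -> ~~ has_low_weight d C -> in_polytope d l signed_point.
Proof.
move=> sTC codeC; have e_gt0 := signed_point_weight_gt0; split.
- under eq_bigr do rewrite -[signed_point _]mul1r.
  by rewrite (sum_signed_point xpredT (fun=> 1)) !mul1r !mulr1 subrK.
(* The points [0], [T] and [C] of the support all lie inside the code [C], and a low-weight word in
   any of them would be one in [C]. *)
- move=> S lowS; have notS (A : {vspace 'rV[F]_n}) :
      (A <= C)%VS -> (S == A) = false.
    move=> sAC; apply: contraNF codeC => /eqP eSA.
    by apply: has_low_weightS lowS; rewrite eSA.
  by rewrite ffunE !notS ?sub0v // !mulr0 subr0 addr0.
- move=> U; rewrite (sum_signed_point (fun S => S <= U)%VS) sub0v mul1r.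
  apply: addr_ge0; last by rewrite !mulr_ge0 ?exprn_ge0 ?ler0n // ltW.
  (* The zero space contributes exactly [1], and the choice of [e] makes the term at [T] equal to
     minus the truth value of [T <= U]. *)
  rewrite card_vspace_rV dimv0 expn0 expr1n mulrCA /e mulVf ?mulr1.
    by rewrite subr_ge0 lern1 leq_b1.
  by rewrite expf_neq0 // pnatr_eq0 -lt0n card_vspace_gt0.
- move=> U; under eq_bigr do rewrite -[signed_point _]mul1r.
  rewrite (sum_signed_point (fun S => U <= S)%VS (fun=> 1)) !mulr1.
  (* The term at [0] is nonnegative; after cancelling [e], it remains that [U <= T] implies
     [U <= C]. *)
  rewrite -addrA addr_ge0 ?ler0n // addrC subr_ge0 ler_pM2l // ler_nat.
  by case: (boolP (U <= T)%VS) => // sUT; rewrite (subv_trans sUT sTC).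
Qed.

End SignedPoint.

Theorem proposition5p1 (R : realType) (q : nat) (F : finFieldType)
    (hq : #|F| = q) (n d l : nat)
    (hn : (0 < n)%N) (hd : (0 < d)%N) (hl : (0 < l)%N) (hln : (n <= l)%N)
    (k0 : nat) (hk0 : ALin F n d = (q ^ k0)%N) (hk0_ge2 : (2 <= k0)%N) :
  ~ polytope_integral R F n d l /\
  (exists P : {ffun {vspace 'rV[F]_n} -> R},
     in_polytope d l P /\ exists S : {vspace 'rV[F]_n}, P S < 0).
Proof.
move: hk0; rewrite -hq => /ALin_attained[C codeC dimC].
have C_neq0 : C != 0%VS by rewrite -dimv_eq0 dimC -lt0n ltnW.
(* [vpick C] is a nonzero vector of [C], so [T] is a line, and it is proper in [C] because [\dim C]
   is at least 2. *)
pose T := <[vpick C]>%VS.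
have dimT : \dim T = 1%N by rewrite dim_vline vpick0 C_neq0.
have T_neq0 : T != 0%VS by rewrite -dimv_eq0 dimT.
have sTC : (T <= C)%VS by rewrite -memvE memv_pick.
have T_neqC : T != C.
  by apply: contraTneq hk0_ge2 => eTC; rewrite -dimC -eTC dimT.
have inP := signed_point_in_polytope R l sTC codeC.
have negP := signed_point_lt0 R l T_neq0 T_neqC.
split; last by exists (signed_point R l T C); split=> //; exists T.
by move=> /(_ _ inP T); rewrite leNgt negP.
Qed.
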